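(* Let $\mathcal{H}_M$ be a (real or complex) Hilbert space of finite dimension $M$, and let $\{\varphi_i\}_{i=1}^{N}$ be a frame for $\mathcal{H}_M$ with frame bounds $A\le B$. Let $b:=\left(\frac{A}{N},\frac{A}{N},\ldots,\frac{A}{N}\right)\in\mathbb{R}^N$. For any $x\in\mathcal{H}_M$ with $\|x\|=1$, let $a=(a_i)_{i=1}^N\in\mathbb{R}^N$ be the sequence $(|\langle x,\varphi_i\rangle|^2)_{i=1}^N$ rearranged in non-increasing order. Then $a\succ_W b$. In particular, $a_1\ge A/N$. Moreover, if there exists $m\in\{1,\ldots,N\}$ such that $\sum_{i=1}^m a_i=m\frac{A}{N}$, then $a_i=A/N$ for all $i\in\{m+1,\ldots,N\}$.
   Context: A family $\{\varphi_i\}_{i=1}^N$ in $\mathcal{H}_M$ is a frame with frame bounds $A,B$, where $0<A\le B<\infty$, if $A\|x\|^2\le\sum_{i=1}^N|\langle x,\varphi_i\rangle|^2\le B\|x\|^2$ for all $x\in\mathcal{H}_M$ (the bounds need not be optimal). For vectors $a=(a_i)_{i=1}^N$ and $b=(b_i)_{i=1}^N$ with non-negative, non-increasing components, $a$ weakly majorizes $b$, written $a\succ_W b$, if $\sum_{i=1}^k a_i\ge\sum_{i=1}^k b_i$ for all $k\in\{1,\ldots,N\}$ (no equality of total sums is required). *)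

(* Defs.v *)
From mathcomp Require Import all_boot all_order all_algebra.
From mathcomp Require Import reals complex.

Set Implicit Arguments.
Unset Strict Implicit.
Unset Printing Implicit Defensive.

Import Order.TTheory GRing.Theory Num.Theory.
Local Open Scope ring_scope.

Variant scalar_kind := RealScalars | ComplexScalars.

Definition scalars (R : realType) (s : scalar_kind) : numFieldType :=
  match s with
  | RealScalars => R
  | ComplexScalars => R[i]%C
  end.

Definition sconj (R : realType) (s : scalar_kind) :
    scalars R s -> scalars R s :=
  match s return scalars R s -> scalars R s with
  | RealScalars => idfun
  | ComplexScalars => (@Num.conj R[i]%C : R[i]%C -> R[i]%C)
  end.
Arguments sconj {R s}.

Definition sre (R : realType) (s : scalar_kind) : scalars R s -> R :=
  match s return scalars R s -> R with
  | RealScalars => idfun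
  | ComplexScalars => @complex.Re R
  end.
Arguments sre {R s}.

(* The library norm [`|z|] takes its values in the scalar field itself; this is
   the modulus as an element of [R]. *)
Definition modulus (R : realType) (s : scalar_kind) (z : scalars R s) : R :=
  sre `|z|.

(* An inner product on [H] is a positive definite sesquilinear form
   [{dot H for sconj}], linear in its first argument.  Since [H] is finite
   dimensional, it is automatically complete. *)
Definition hnorm (R : realType) (s : scalar_kind) (H : vectType (scalars R s))
    (ip : {dot H for @sconj R s}) (x : H) : R :=
  Num.sqrt (sre (ip x x)).

Definition is_frame (R : realType) (s : scalar_kind)
    (H : vectType (scalars R s)) (ip : {dot H for @sconj R s}) (N : nat)
    (phi : 'I_N -> H) (A B : R) : Prop :=
  [/\ 0 < A, A <= B
    & forall x : H,
        A * hnorm ip x ^+ 2 <= \sum_(i < N) modulus (ip x (phi i)) ^+ 2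
        /\ \sum_(i < N) modulus (ip x (phi i)) ^+ 2 <= B * hnorm ip x ^+ 2].

Definition nonincr_rearrangement (R : realType) (N : nat) (u : N.-tuple R) :
    N.-tuple R :=
  [tuple of sort >=%R u].

Definition nonneg_nonincr (R : realType) (N : nat) (u : N.-tuple R) : bool :=
  all (>= 0) u && sorted >=%R u.

(* The relation is only meant for vectors with non-negative, non-increasing
   components, so this is part of the definition.  Components are numbered
   from 0: [\sum_(i < k) a`_i] is the sum of the first [k] of them. *)
Definition weakly_majorizes (R : realType) (N : nat) (a b : N.-tuple R) : Prop :=
  [/\ nonneg_nonincr a, nonneg_nonincr b
    & forall k : nat, (1 <= k <= N)%N ->
        \sum_(i < k) b`_i <= \sum_(i < k) a`_i].

(* Main.v *)
(** Let [c = A / N].  At a unit vector the lower frame bound says that the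
    squared coefficients have sum at least [N * c].  If the [k]-th largest is at
    least [c], then so are the [k] largest, hence their sum is at least [k * c];
    otherwise the remaining [N - k] are below [c], so at least [k * c] is left
    for the first [k].  If the [m] largest have sum exactly [m * c], the
    remaining ones are at most [c] and have sum at least [(N - m) * c], so they
    all equal [c]. *)

Require Import Defs.
From mathcomp Require Import all_boot all_order all_algebra.
From mathcomp Require Import reals complex.
Import Order.TTheory GRing.Theory Num.Theory.
Local Open Scope ring_scope.

Section NonincreasingSums.
Variables (R : realDomainType) (f : nat -> R) (N : nat) (c : R).
Hypothesis f_nonincr : forall i j, (i <= j < N)%N -> f j <= f i.
Hypothesis sum_ge : c *+ N <= \sum_(0 <= i < N) f i.

Lemma nonincr_prefix_sum_ge k : (k <= N)%N -> c *+ k <= \sum_(0 <= i < k) f i.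
Proof.
case: k => [|k] leN; first by rewrite big_nil mulr0n.
(* Indices start at 0, so [f k] is the last, hence smallest, of the [k.+1] terms in the prefix. *)
case: (lerP c (f k)) => fk.
  rewrite -{1}[k.+1]subn0 -sumr_const_nat; apply: ler_sum_nat => i ik.
  by apply: (le_trans fk); apply: f_nonincr; rewrite -ltnS leN andbT.
(* Adding [c] once for each index past the prefix makes the left side [c *+ N], so [sum_ge] applies
   and only the tails remain to be compared. *)
rewrite -(lerD2r (c *+ (N - k.+1))) -mulrnDr subnKC //.
apply: (le_trans sum_ge); rewrite (big_cat_nat _ leN) //= lerD2l -sumr_const_nat.
apply: ler_sum_nat => i /andP[ki iN].
by apply: le_trans (ltW fk); apply: f_nonincr; rewrite (ltnW ki).
Qed.

Lemma nonincr_prefix_sum_eq m i : (0 < m)%N -> (m <= i < N)%N ->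
  \sum_(0 <= j < m) f j = c *+ m -> f i = c.
Proof.
case: m => // m _ /andP[mi iN] sumE.
have mN : (m.+1 <= N)%N by apply: leq_trans (ltnW iN).
(* If the smallest term of the prefix exceeded [c], the prefix sum would be strictly larger than
   [c *+ m.+1]. *)
have fm : f m <= c.
  rewrite leNgt; apply/negP => fm.
  have : \sum_(0 <= j < m.+1) c < \sum_(0 <= j < m.+1) f j.
    apply: ltr_sum_nat => // j jm.
    by apply: (lt_le_trans fm); apply: f_nonincr; rewrite -ltnS mN andbT.
  by rewrite sumr_const_nat subn0 sumE ltxx.
have f_le j : (m.+1 <= j < N)%N -> f j <= c.
  move=> /andP[mj jN]; apply: le_trans fm.
  by apply: f_nonincr; rewrite (ltnW mj).
(* The filter repeats the range so that [f_le] can be applied to each summand: non-negative terms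
   with sum zero all vanish. *)
have tail0 : \sum_(m.+1 <= j < N | (m < j < N)%N) (c - f j) = 0.
  apply/eqP; rewrite eq_le sumr_ge0 => [|j /f_le]; last by rewrite subr_ge0.
  rewrite andbT -big_nat sumrB sumr_const_nat subr_le0.
  move: sum_ge; rewrite (big_cat_nat _ mN) //= sumE -{1}(subnKC mN) mulrnDr.
  by rewrite lerD2l.
move/eqP: tail0; rewrite psumr_eq0 => [|j /f_le]; last by rewrite subr_ge0.
move=> /allP /(_ i); rewrite mem_index_iota mi iN /= subr_eq0.
by move=> /(_ isT) /eqP.
Qed.

End NonincreasingSums.

Theorem theorem4p4 (R : realType) (s : scalar_kind) (M N : nat)
    (H : vectType (scalars R s)) (dimH : \dim {:H} = M)
    (ip : {dot H for @sconj R s})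
    (phi : 'I_N -> H) (A B : R) (frame_phi : is_frame ip phi A B)
    (x : H) (norm_x : hnorm ip x = 1) :
  let a := nonincr_rearrangement
             [tuple modulus (ip x (phi i)) ^+ 2 | i < N] in
  let b := [tuple A / N%:R | i < N] in
  [/\ weakly_majorizes a b,
      A / N%:R <= a`_0
    & forall m : nat, (1 <= m <= N)%N ->
        \sum_(i < m) a`_i = m%:R * (A / N%:R) ->
        forall i : nat, (m <= i < N)%N -> a`_i = A / N%:R].
Proof.
case: frame_phi => A_gt0 _ /(_ x)[]; rewrite norm_x expr1n mulr1 => A_le _.
set t := [tuple _ | i < N]; move=> a b; set c := A / N%:R.
have N_gt0 : (0 < N)%N.
  (* An empty family would have coefficient sum 0, which is not at least [A > 0]. *)
  rewrite lt0n; apply: contraTneq (lt_le_trans A_gt0 A_le) => N0.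
  by rewrite big1 ?ltxx // => i; have := ltn_ord i; rewrite {2}N0.
have a_sorted : sorted >=%R a by apply: sort_sorted; apply: ge_total.
have a_nonincr i j : (i <= j < N)%N -> a`_j <= a`_i.
  move=> /andP[ij jN].
  apply: (sorted_leq_nth ge_trans ge_refl 0 a_sorted) => //;
    by rewrite inE size_tuple // (leq_ltn_trans ij).
have sum_a : c *+ N <= \sum_(0 <= i < N) a`_i.
  have -> : c *+ N = A by rewrite -mulr_natr divfK // pnatr_eq0 -lt0n.
  (* Sorting only permutes the entries of [t], so the frame bound carries over to [a]. *)
  have -> : \sum_(0 <= i < N) a`_i = \sum_(y <- t) y.
    rewrite -(perm_big _ (permEl (perm_sort >=%R t))) /=.
    by rewrite [RHS](big_nth 0) (size_tuple a).
  by rewrite big_tuple; under eq_bigr do rewrite tnth_mktuple.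
have b_nth i : (i < N)%N -> b`_i = c.
  by move=> iN; rewrite -(tnth_nth 0 b (Ordinal iN)) tnth_mktuple.
have prefix := nonincr_prefix_sum_ge _ _ _ _ a_nonincr sum_a.
split.
- split.
  + rewrite /nonneg_nonincr a_sorted andbT all_sort.
    by apply/allP => _ /mapP[i _ ->]; apply: sqr_ge0.
  (* As a constant list, [b] is sorted by reflexivity of the order. *)
  + rewrite /nonneg_nonincr; have -> : b = nseq N c :> seq R.
      apply: (@eq_from_nth _ 0); rewrite (size_tuple b) ?size_nseq // => i iN.
      by rewrite b_nth // nth_nseq iN.
    rewrite all_nseq divr_ge0 ?ler0n ?(ltW A_gt0) // orbT /=.
    by apply/(sortedP 0) => i; rewrite size_nseq => iN;
      rewrite !nth_nseq iN ltnW /=.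
  + move=> k /andP[_ kN]; rewrite -[leRHS](big_mkord xpredT) /=.
    apply: le_trans (prefix k kN); rewrite (eq_bigr (fun=> c)).
      by rewrite sumr_const card_ord.
    by move=> i _; rewrite b_nth // (leq_trans _ kN).
- by have := prefix 1 N_gt0; rewrite big_nat1.
- move=> m /andP[m_gt0 _]; rewrite -(big_mkord xpredT (nth 0 a)) mulr_natl.
  move=> sumE i miN.
  exact: nonincr_prefix_sum_eq a_nonincr sum_a _ _ m_gt0 miN sumE.
Qed.
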